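(* Let $t,n_1,n_2$ be positive integers, and put $n_*:=\min\{n_1,n_2\}$. If $n_*\ge 128\cdot 2^t$, then $$z(n_1,n_2;t,t)<128^{1/t}\,n_1n_2\,n_*^{-1/t}.$$
   Context: For vertex classes $V_1,V_2$ of sizes $n_1,n_2$, $z(n_1,n_2;s,t)$ denotes the maximum number of edges in a bipartite graph with vertex classes $V_1$ (first) and $V_2$ (second) containing no complete bipartite subgraph $K_{s,t}$ with its $s$ vertices in the first class and its $t$ vertices in the second class. *)

(* Defs.v *)
From mathcomp Require Import all_boot all_order all_algebra.
From mathcomp Require Import reals exp.

Set Implicit Arguments.
Unset Strict Implicit.
Unset Printing Implicit Defensive.

(* A bipartite graph with first class V1 and second class V2 is given by its
   edge set E : {set V1 * V2}.  The copy is ordered (s vertices in V1, t in V2)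
   and not necessarily induced. *)
Definition contains_Kst (V1 V2 : finType) (s t : nat) (E : {set V1 * V2}) :
    bool :=
  [exists A : {set V1}, exists B : {set V2},
    [&& #|A| == s, #|B| == t & setX A B \subset E]].

(* For s, t > 0 the maximum is over a nonempty family, since it contains the
   empty graph; if s = 0 or t = 0 the family may be empty, with value 0. *)
Definition zarankiewicz (n1 n2 s t : nat) : nat :=
  \max_(E : {set 'I_n1 * 'I_n2} | ~~ contains_Kst s t E) #|E|.

(* Main.v *)
Require Import Defs.
From mathcomp Require Import all_boot all_order all_algebra.
From mathcomp Require Import reals exp.
From mathcomp Require Import zify ring lra.
Import Order.TTheory GRing.Theory Num.Theory.
Local Open Scope ring_scope.

Set Implicit Arguments.
Unset Strict Implicit.
Unset Printing Implicit Defensive.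

(** Put n = min(n1, n2) and p = (128 / n)^(1/t), so that n p^t = 128 and the
    hypothesis on n says exactly that p <= 1/2.  The claim is that a bipartite
    graph of density at least p, with at least n vertices on each side,
    contains K_{t,t}.

    The Kovari-Sos-Turan averaging argument picks a t-subset of the first class
    with about n p^t = 128 common neighbours, which suffices only for small t
    (here t <= 120).  For larger t it is applied alternately on the two sides,
    each time choosing only part of the vertices that are still missing.  Suppose
    K_{a,b} is wanted between X and Y, where |X| p^b and |Y| p^a are bounded
    below by a constant and b is about 3 log2 a.  Pick a - k vertices of X with a
    large common neighbourhood N, where k is about 3 log2 b; then it is enough to
    find K_{b,k} between N and the rest of X, and |N| p^k is about
    |Y| p^(a-k) p^k, so both lower bounds survive.  The demand decreases
    logarithmically, until at most 44 vertices are wanted on one side and a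
    single averaging step finishes.

    To iterate, the new pair must again have density about p.  This is arranged
    by counting only those common neighbours whose degree is at least a fraction
    r < 1 of the average (exists_heavy_core): in the s-th moment of the degrees,
    the vertices below that threshold contribute at most a proportion r^s.  The
    density becomes r p, which costs a factor r^b in |X| p^b and r^k in |N| p^k.
    When b is logarithmic in a, the choice r = 1 - 4/b^2 makes all these losses
    O(1/b), and the lower bound 60 - 600/b on the two sizes absorbs them
    (biclique_log).  Only in the first step, from (t, t) to (t, k), must one pay
    a constant: there r^t = 1/2, which turns 128 into 64 on both sides up to
    lower-order terms (balanced_biclique). *)

(** * Power inequalities *)

Section RealIneq.
Variable R : realFieldType.
Implicit Types x y m : R.

(** The graph of [x ^+ n.+1] lies above its tangent at [m]; this single convexity
    fact yields Bernoulli's inequality and the power mean inequality below. *)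
Lemma expr_ge_tangent x m n : 0 <= x -> 0 <= m ->
  m ^+ n.+1 + n.+1%:R * m ^+ n * (x - m) <= x ^+ n.+1.
Proof.
move=> x0 m0; elim: n => [|n IH]; first by rewrite !expr1 expr0; lra.
have h := ler_wpM2l x0 IH.
rewrite [x ^+ n.+2]exprS; apply: (le_trans _ h).
rewrite -subr_ge0 (_ : _ - _ = n.+1%:R * m ^+ n * (x - m) ^+ 2).
  by apply: mulr_ge0; rewrite ?sqr_ge0 ?mulr_ge0 ?exprn_ge0.
by rewrite !exprS -[n.+2%:R]natr1; ring.
Qed.

Lemma bernoulli x n : 0 <= x <= 1 -> 1 - n%:R * x <= (1 - x) ^+ n.
Proof.
move=> /andP[x0 x1]; case: n => [|n]; first by rewrite expr0; lra.
have := @expr_ge_tangent (1 - x) 1 n _ ler01.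
rewrite !expr1n; move=> /(_ ltac:(lra)); lra.
Qed.

(** Bernoulli's inequality for [(1 - x)^-1 >= 1 + x], stated without division;
    this upper bound is what makes the low-degree vertices negligible. *)
Lemma bernoulli_inv x n : 0 <= x <= 1 -> (1 - x) ^+ n * (1 + n%:R * x) <= 1.
Proof.
move=> /andP[x0 x1]; elim: n => [|n IH]; first by rewrite expr0; lra.
apply: (le_trans _ IH); rewrite exprSr -mulrA ler_wpM2l ?exprn_ge0 ?subr_ge0//.
have := mulr_ge0 (ler0n R n) (sqr_ge0 x); have := sqr_ge0 x.
rewrite -(natr1 n); nra.
Qed.

Lemma exprB_le x y n : 0 <= y <= x -> x <= 1 -> x ^+ n - y ^+ n <= n%:R * (x - y).
Proof.
move=> /andP[y0 yx] x1; case: n => [|n]; first by rewrite !expr0; lra.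
have x0 : 0 <= x by lra.
have := @expr_ge_tangent y x n y0 x0.
have : n.+1%:R * x ^+ n * (x - y) <= n.+1%:R * (x - y).
  by rewrite -mulrA ler_wpM2l// ler_piMl ?subr_ge0// exprn_ile1.
lra.
Qed.

(** Power mean inequality: the tangents at [m] add up to at least the bound. *)
Lemma sum_expr_ge (I : finType) (A : {set I}) (f : I -> R) m n :
  0 <= m -> (forall i, 0 <= f i) -> #|A|%:R * m <= \sum_(i in A) f i ->
  #|A|%:R * m ^+ n <= \sum_(i in A) f i ^+ n.
Proof.
move=> m0 f0 hm; case: n => [|n].
  by under eq_bigr do rewrite expr0; rewrite sumr_const expr0 mulr1.
apply: le_trans (_ : \sum_(i in A) (m ^+ n.+1 + n.+1%:R * m ^+ n * (f i - m)) <= _).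
  rewrite big_split -mulr_sumr sumrB !sumr_const -[m ^+ _ *+ _]mulr_natl.
  rewrite lerDl mulr_ge0 ?mulr_ge0 ?exprn_ge0//.
  by rewrite subr_ge0 -[m *+ _]mulr_natl.
by apply: ler_sum => i _; exact: expr_ge_tangent.
Qed.
End RealIneq.

Lemma expn_le_ffact d s : ((d - s) ^ s <= d ^_ s)%N.
Proof.
rewrite ffact_prod -[X in (_ ^ X)%N]card_ord -prod_nat_const.
by apply: leq_prod => i _; rewrite leq_sub2l// ltnW.
Qed.

Lemma ffact_le_expn d s : (d ^_ s <= d ^ s)%N.
Proof.
rewrite ffact_prod -[X in (_ ^ X)%N]card_ord -prod_nat_const.
by apply: leq_prod => i _; exact: leq_subr.
Qed.

(** * Exponential against polynomial growth *)

(** From [m] on, one step multiplies [n ^ d] by at most [(m.+1 / m) ^ d], hence by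
    at most 2, so the inequality propagates from its first instance. *)
Lemma exp2_dominates c C d m n : (m.+1 ^ d <= 2 * m ^ d)%N ->
  (c * m ^ d <= C * 2 ^ m)%N -> (0 < m <= n)%N -> (c * n ^ d <= C * 2 ^ n)%N.
Proof.
move=> hd hm /andP[m0 /subnK <-].
elim: (n - m)%N => [//|k IH]; set j := (k + m)%N in IH *.
have mj : (m <= j)%N by rewrite leq_addl.
have -> : (k.+1 + m = j.+1)%N by [].
have h : (j.+1 ^ d <= 2 * j ^ d)%N.
  have md : (0 < m ^ d)%N by rewrite expn_gt0 m0.
  rewrite -(leq_pmul2r md) -expnMn mulnAC.
  apply: leq_trans (_ : (m.+1 ^ d * j ^ d <= _)%N).
    by rewrite -expnMn; case: (d) => // d'; rewrite leq_exp2r //; nia.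
  by rewrite leq_mul2r hd orbT.
by rewrite expnS; nia.
Qed.

Lemma exp2_ge_pow9 b : (45 <= b)%N -> (b ^ 9 <= 32 * 2 ^ b)%N.
Proof.
move=> hb; rewrite -[(b ^ 9)%N]mul1n; apply: (@exp2_dominates _ _ _ 45); lia.
Qed.

Lemma exp2_ge_pow6 k : (21 <= k)%N -> (k ^ 6 <= 50 * 2 ^ k)%N.
Proof.
by move=> hk; rewrite -[(k ^ 6)%N]mul1n; apply: (@exp2_dominates _ _ _ 21); lia.
Qed.

Lemma exp2_ge_pow3 n : (10 <= n)%N -> (n ^ 3 <= 2 ^ n)%N.
Proof.
by move=> hn; rewrite -[(n ^ 3)%N]mul1n -[(2 ^ n)%N]mul1n;
  apply: (@exp2_dominates _ _ _ 10); lia.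
Qed.

Lemma exp2_ge_sqr n : (n ^ 2 <= 2 * 2 ^ n)%N.
Proof.
case: (leqP 3 n) => hn; last by case: n hn => [|[|[|]]].
by rewrite -[(n ^ 2)%N]mul1n; apply: (@exp2_dominates _ _ _ 3); lia.
Qed.

(** * The logarithmic schedule *)

Lemma up_log_cube a (k := up_log 2 (a ^ 3)) : (1 < a)%N ->
  (a ^ 3 <= 2 ^ k)%N /\ (2 ^ k < 2 * a ^ 3)%N.
Proof.
move=> a1; have h : (1 < a ^ 3)%N by rewrite -(exp1n 3) ltn_exp2r.
have /andP[h1 h2] := up_log_bounds (isT : (1 < 2)%N) h.
split=> //; move: h1; rewrite -/k -(ltn_pmul2l (isT : (0 < 2)%N)) -expnS prednK//.
by rewrite up_log_gt0 h.
Qed.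

Lemma up_log_cube_small b (k := up_log 2 (b ^ 3)) : (45 <= b)%N ->
  (17 <= k)%N /\ (2 * k <= b)%N.
Proof.
move=> hb; have [h1 h2] := @up_log_cube b ltac:(lia); rewrite -/k in h1 h2.
split.
  rewrite leqNgt; apply/negP => hk.
  have : (2 ^ k <= 2 ^ 16)%N by rewrite leq_exp2l.
  have : (45 ^ 3 <= b ^ 3)%N by rewrite leq_exp2r.
  lia.
(* [2 ^ k < 2 * b ^ 3] makes [2 ^ (2 * k)] smaller than [4 * b ^ 6], which is at
   most [2 ^ (b - 3)]. *)
rewrite leqNgt; apply/negP => hk.
have e1 : (1 * b ^ 6 <= 1 * 2 ^ (b - 5))%N.
  have : (32 * b ^ 6 <= 1 * 2 ^ b)%N by apply: (@exp2_dominates _ _ _ 45); lia.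
  have : (2 ^ b = 2 ^ (b - 5) * 2 ^ 5)%N by rewrite -expnD subnK//; lia.
  lia.
have : ((2 ^ k) ^ 2 < (2 * b ^ 3) ^ 2)%N by rewrite ltn_exp2r.
rewrite expnMn -!expnM => e2.
have e3 : (2 ^ (b - 5 + 2) <= 2 ^ (k * 2))%N by rewrite leq_exp2l//; lia.
move: e3; rewrite expnD; lia.
Qed.

Lemma cube_le_of_exp2 a b : (45 <= b)%N -> (2 ^ b < 2 * a ^ 3)%N -> (b ^ 3 <= 4 * a)%N.
Proof.
move=> hb hab; rewrite -(leq_exp2r _ _ (isT : (0 < 3)%N)) expnMn -expnM.
have := exp2_ge_pow9 hb; lia.
Qed.

Lemma log_step_sizes a b (k := up_log 2 (b ^ 3)) :
  (45 <= b)%N -> (2 ^ b < 2 * a ^ 3)%N ->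
  [/\ (17 <= k)%N, (2 * k <= b)%N, (b ^ 3 <= 4 * a)%N & (k < a)%N].
Proof.
move=> hb hab; have [k17 kb] := up_log_cube_small hb.
have ba := cube_le_of_exp2 hb hab; rewrite -/k in k17 kb *; split=> //.
have : (45 * b ^ 2 <= b ^ 3)%N by rewrite [(b ^ 3)%N]expnS leq_mul2r hb orbT.
nia.
Qed.

Lemma first_step_sizes t (k := up_log 2 (t ^ 3)) : (121 <= t)%N ->
  [/\ (21 <= k)%N, (16 * k ^ 2 <= 75 * t)%N & (k < t)%N].
Proof.
move=> ht; have [h1 h2] := @up_log_cube t ltac:(lia); rewrite -/k in h1 h2 *.
have k21 : (21 <= k)%N.
  rewrite leqNgt; apply/negP => hk.
  have : (2 ^ k <= 2 ^ 20)%N by rewrite leq_exp2l.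
  have : (121 ^ 3 <= t ^ 3)%N by rewrite leq_exp2r.
  lia.
have kt : (16 * k ^ 2 <= 75 * t)%N.
  rewrite -(leq_exp2r _ _ (isT : (0 < 3)%N)) expnMn -expnM [leqRHS]expnMn.
  have := exp2_ge_pow6 k21; lia.
by split=> //; nia.
Qed.

Lemma ge32_of_exp2_cube a b : (16 <= b)%N -> (2 ^ b < 2 * a ^ 3)%N -> (32 <= a)%N.
Proof.
move=> b16 ab; rewrite leqNgt; apply/negP => ha.
have : (a ^ 3 <= 31 ^ 3)%N by rewrite leq_exp2r.
have : (2 ^ 16 <= 2 ^ b)%N by rewrite leq_exp2l.
lia.
Qed.

(** * Choosing part of a biclique by averaging *)

Section Bip.
Variables U W : finType.
Variable e : U -> W -> bool.

Definition edges (X : {set U}) (Y : {set W}) : nat :=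
  (\sum_(y in Y) \sum_(x in X) e x y)%N.

Definition has_biclique (X : {set U}) (Y : {set W}) (a b : nat) : Prop :=
  exists (S : {set U}) (T : {set W}), [/\ S \subset X, T \subset Y, #|S| = a, #|T| = b &
                  {in S & T, forall x y, e x y}].

Definition nbhd (X : {set U}) (y : W) : {set U} := [set x in X | e x y].

Lemma card_nbhd X y : #|nbhd X y| = (\sum_(x in X) e x y)%N.
Proof.
rewrite -sum1_card big_mkcond [RHS]big_mkcond; apply: eq_bigr => x _.
by rewrite inE; case: (x \in X) (e x y) => [] [].
Qed.

Lemma edgesE X Y : edges X Y = (\sum_(y in Y) #|nbhd X y|)%N.
Proof. by apply: eq_bigr => y _; rewrite card_nbhd. Qed.

Section Step.
Variable R : realFieldType.

(** Average [#|N|] over all s-subsets [S] of [X], where [N] consists of the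
    vertices of [Y] that are complete to [S] and have degree at least [m].
    Double counting gives the sum of ['C(d y, s)] over the vertices [y] of degree
    [d y >= m].  By convexity all vertices together contribute at least what they
    would if all degrees were the average one, and each vertex below [m]
    contributes at most [m ^ s]. *)
Lemma exists_heavy_core (X : {set U}) (Y : {set W}) (p m : R) s :
  0 <= m -> p <= 1 -> s%:R <= p * #|X|%:R ->
  p * #|X|%:R * #|Y|%:R <= (edges X Y)%:R ->
  exists (S : {set U}) (N : {set W}), [/\ S \subset X, #|S| = s, N \subset Y,
    {in S & N, forall x y, e x y} /\ (forall y, y \in N -> m <= #|nbhd X y|%:R) &
    #|Y|%:R * ((p * #|X|%:R - s%:R) ^+ s - m ^+ s) <= #|N|%:R * #|X|%:R ^+ s].
Proof.
move=> m0 p1 hs hp.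
pose N (S : {set U}) :=
  [set y in Y | (m <= #|nbhd X y|%:R) && (S \subset nbhd X y)].
pose D := [set S : {set U} | S \subset X & #|S| == s].
pose beta := #|Y|%:R * ((p * #|X|%:R - s%:R) ^+ s - m ^+ s).
have sX : (s <= #|X|)%N.
  rewrite -(ler_nat R) (le_trans hs)// ler_piMl//.
suff [S SD hS] : exists2 S, S \in D & beta <= #|N S|%:R * #|X|%:R ^+ s.
  move: SD; rewrite inE => /andP[SX /eqP Ss].
  exists S, (N S); split=> //; first by apply/subsetP => y; rewrite inE => /andP[].
  split=> [x y xS|y]; rewrite inE => /and3P[_ hm SN] //.
  by move/subsetP: SN => /(_ _ xS); rewrite inE => /andP[].
apply/exists_inP; apply: contraT => /exists_inPn H.
have cD : #|D| = 'C(#|X|, s) by rewrite cards_draws.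
have D0 : (0 < #|D|)%N by rewrite cD bin_gt0.
have [S0 S0D] : exists S, S \in D by apply/set0Pn; rewrite -card_gt0.
have beta0 : 0 < beta.
  have := H _ S0D; rewrite -ltNge; apply: le_lt_trans.
  by rewrite mulr_ge0 ?exprn_ge0.
pose d y := #|nbhd X y|; pose hv y : bool := m <= (d y)%:R.
have dbl : (\sum_(S in D) #|N S| = \sum_(y in Y | hv y) 'C(d y, s))%N.
  under eq_bigr do rewrite -sum1_card.
  rewrite (exchange_big_dep (fun y => (y \in Y) && (hv y))) /=; last first.
    by move=> S y _; rewrite inE => /and3P[-> ? _].
  apply: eq_bigr => y /andP[yY hy]; rewrite sum1_card -cards_draws.
  apply: eq_card => S; rewrite unfold_in /D /N !inE. rewrite yY [m <= _]hy /=.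
  case: (boolP (S \subset nbhd X y)) => [h|]; rewrite ?andbF ?andbT //=.
  have -> : S \subset X; last by [].
  by apply: (subset_trans h); apply/subsetP => x; rewrite inE => /andP[].
have up : (\sum_(S in D) #|N S|)%:R * #|X|%:R ^+ s < 'C(#|X|, s)%:R * beta.
  rewrite natr_sum mulr_suml -cD mulr_natl -[ltRHS]sumr_const.
  apply: ltr_sum; first by apply/hasP; exists S0; rewrite ?mem_index_enum.
  by move=> S SD; have := H _ SD; rewrite -ltNge.
(* The truncated difference [d y - s] is 0 for degrees below [s], so that the power
   mean inequality applies to all of [Y]. *)
have low : beta <= (\sum_(y in Y | hv y) (d y) ^_ s)%:R.
  rewrite natr_sum.
  have h1 : #|Y|%:R * (p * #|X|%:R - s%:R) ^+ s <= \sum_(y in Y) ((d y - s)%N%:R : R) ^+ s.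
    apply: sum_expr_ge; rewrite ?subr_ge0//.
    rewrite mulrBr [#|Y|%:R * (_ * _)]mulrC.
    apply: le_trans (_ : \sum_(y in Y) ((d y)%:R - s%:R) <= _).
      rewrite sumrB sumr_const -[s%:R *+ _]mulr_natl lerD2r -natr_sum -edgesE //.
    apply: ler_sum => y _; rewrite lerBlDr -natrD ler_nat; lia.
  rewrite /beta mulrBr lerBlDr; apply: (le_trans h1).
  rewrite (bigID (fun y => hv y)) /= lerD//.
    by apply: ler_sum => y _; rewrite -natrX ler_nat expn_le_ffact.
  apply: le_trans (_ : \sum_(y in Y) m ^+ s <= _); last first.
    by rewrite sumr_const mulr_natl.
  rewrite [leRHS](bigID (fun y => hv y)) /= -[leLHS]add0r lerD//.
    by apply: sumr_ge0 => y _; rewrite exprn_ge0.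
  apply: ler_sum => y /andP[_]; rewrite -ltNge => /ltW hy.
  rewrite lerXn2r ?nnegrE//; apply: le_trans hy; rewrite ler_nat; lia.
have := up; rewrite dbl.
rewrite -(ltr_pM2l (_ : 0 < (s`!)%:R)) ?ltr0n ?fact_gt0// !mulrA -!natrM.
rewrite big_distrr /=; under eq_bigr do rewrite mulnC bin_ffact.
rewrite [(s`! * _)%N]mulnC bin_ffact => up2.
have X0 : 0 <= #|X|%:R ^+ s :> R by rewrite exprn_ge0.
have a1 := ler_wpM2r X0 low.
have a2 : (#|X| ^_ s)%:R * beta <= #|X|%:R ^+ s * beta.
  by rewrite ler_pM2r// -natrX ler_nat ffact_le_expn.
have a3 := le_trans a2 (eq_ind _ (fun z => z <= _) a1 _ (mulrC _ _)).
by move: up2; rewrite natrM -mulrA -/beta ltNge a3.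
Qed.
End Step.
End Bip.

Section Relative.
Variable R : realFieldType.
Variables U W : finType.
Variable e : U -> W -> bool.
Implicit Types (X S : {set U}) (Y N : {set W}) (p r tau : R).

Definition dense p X Y := p * #|X|%:R * #|Y|%:R <= (edges e X Y)%:R.

(** The same averaging with the threshold at [r] times the average degree, plus [s]
    to allow for the removal of [S] from [X].  The parameter [tau] bounds
    [s ^ 2 / (p * #|X|)], which is the relative cost of choosing [s] distinct
    vertices; it enters twice, through the average and through the threshold. *)
Lemma exists_heavy_core_rel X Y p r tau s :
  0 < p <= 1 -> 0 <= r -> 0 <= tau -> r + tau <= 1 -> (0 < s)%N ->
  s%:R ^+ 2 <= tau * (p * #|X|%:R) -> dense p X Y ->
  exists (S : {set U}) (N : {set W}), [/\ S \subset X, #|S| = s, N \subset Y,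
    {in S & N, forall x y, e x y} /\
    (forall y, y \in N -> r * (p * #|X|%:R) + s%:R <= #|nbhd e X y|%:R) &
    #|Y|%:R * p ^+ s * (1 - 2 * tau - r ^+ s) <= #|N|%:R].
Proof.
move=> /andP[p0 p1] r0 tau0 rt s0 hs hd.
have s1 : 1 <= s%:R :> R by rewrite ler1n.
set A := #|X|%:R in hs *; set s' := s%:R in hs s1 *.
have A0 : 0 <= A :> R by rewrite ler0n.
have pA : 0 < p * A.
  have : 0 <= p * A by rewrite mulr_ge0// ltW.
  rewrite le_eqVlt => /orP[/eqP E|//]; move: hs; rewrite -E mulr0.
  nra.
have A1 : 0 < A by move: pA; rewrite pmulr_rgt0.
pose sg := s' / (p * A).
have sgE : s' = sg * (p * A) by rewrite /sg divfK// gt_eqF.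
have sg0 : 0 <= sg by rewrite divr_ge0 ?(ltW pA)//; lra.
have ssg : s' * sg <= tau.
  by rewrite /sg mulrA ler_pdivrMr// -expr2.
have sgt : sg <= tau by apply: le_trans ssg; rewrite ler_peMl.
have tau1 : tau <= 1 by lra.
have hsA : s' <= p * A by rewrite sgE ler_piMl ?(ltW pA)//; lra.
have m0 : 0 <= r * (p * A) + s'.
  by rewrite addr_ge0 ?mulr_ge0 ?(ltW pA)//; lra.
have [S [N [SX Ss NY [cpl hN] big]]] := exists_heavy_core m0 p1 hsA hd.
exists S, N; split=> //.
have As : 0 < A ^+ s by rewrite exprn_gt0.
rewrite -(ler_pM2r As); apply: le_trans big.
rewrite -!mulrA ler_wpM2l//.
have -> : p * A - s' = (1 - sg) * (p * A) by rewrite sgE; ring.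
have -> : r * (p * A) + s' = (r + sg) * (p * A) by rewrite sgE; ring.
have -> c : p ^+ s * (c * A ^+ s) = (p * A) ^+ s * c by rewrite exprMn; ring.
rewrite [((1 - sg) * _) ^+ s]exprMn [((r + sg) * _) ^+ s]exprMn -mulrBl.
rewrite [leRHS]mulrC.
rewrite ler_wpM2l ?exprn_ge0 ?(ltW pA)//.
have b1 : 1 - s' * sg <= (1 - sg) ^+ s by apply: bernoulli; lra.
have b2 : (r + sg) ^+ s - r ^+ s <= s' * (r + sg - r) by apply: exprB_le; lra.
have b3 : r + sg - r = sg by ring.
rewrite b3 in b2; lra.
Qed.

(** A single averaging step, with no degree threshold ([r = 0]). *)
Lemma biclique_direct X Y p tau a b :
  0 < p <= 1 -> 0 <= tau <= 1 -> (0 < a)%N ->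
  a%:R ^+ 2 <= tau * (p * #|X|%:R) -> dense p X Y ->
  b%:R <= #|Y|%:R * p ^+ a * (1 - 2 * tau) ->
  has_biclique e X Y a b.
Proof.
move=> hp /andP[t0 t1] a0 ha hd hb.
have [|S [N [SX Sa NY [cpl _] big]]] :=
  @exists_heavy_core_rel X Y p 0 tau a hp (lexx _) t0 _ a0 ha hd; first by rewrite add0r.
rewrite expr0n -[a == _]negbK -lt0n a0 subr0 in big.
have bN : (b <= #|N|)%N by rewrite -(ler_nat R) (le_trans hb).
have [T] : exists T, T \in [set T : {set W} | T \subset N & #|T| == b].
  by apply/set0Pn; rewrite -card_gt0 cards_draws bin_gt0.
rewrite inE => /andP[TN /eqP Tb]; exists S, T; split=> //.
  exact: subset_trans NY.
by move=> x y xS yT; apply: cpl => //; exact: (subsetP TN).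
Qed.
End Relative.

Definition converse (U W : finType) (e : U -> W -> bool) : W -> U -> bool :=
  fun y x => e x y.

Lemma edges_converse (U W : finType) (e : U -> W -> bool) X Y :
  edges (converse e) Y X = edges e X Y.
Proof. by rewrite /edges exchange_big. Qed.

(** Fixing [s] vertices on the side of [X] leaves a smaller biclique to be found
    between their common neighbourhood and the rest of [X].  The two sides are
    exchanged, so that the long side of the demand always comes first. *)
Lemma biclique_reduce (R : realFieldType) (U W : finType) (e : U -> W -> bool)
    (X : {set U}) (Y : {set W}) (p r tau : R) s k b :
  0 < p <= 1 -> 0 <= r -> 0 <= tau -> r + tau <= 1 -> (0 < s)%N ->
  s%:R ^+ 2 <= tau * (p * #|X|%:R) -> dense e p X Y ->
  (forall (N : {set W}) (X' : {set U}),
     #|Y|%:R * p ^+ s * (1 - 2 * tau - r ^+ s) <= #|N|%:R ->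
     (1 - tau) * #|X|%:R <= #|X'|%:R ->
     dense (converse e) (r * p) N X' -> has_biclique (converse e) N X' b k) ->
  has_biclique e X Y (s + k) b.
Proof.
move=> hp r0 t0 rt s0 hs hd IH.
have [S [N [SX Ss NY [cpl hN] big]]] := exists_heavy_core_rel hp r0 t0 rt s0 hs hd.
case/andP: hp => p0 p1.
have cX : #|X :\: S|%:R = #|X|%:R - s%:R :> R.
  by rewrite cardsD (setIidPr SX) Ss natrB// -Ss subset_leq_card.
have [||T [S' [TN S'X Tb S'k cpl']]] := IH N (X :\: S) big.
- rewrite cX.
  have : s%:R <= tau * #|X|%:R :> R.
    apply: le_trans (_ : s%:R ^+ 2 <= _).
      by rewrite expr2 -natrM ler_nat leq_pmulr.
    by apply: (le_trans hs); rewrite ler_wpM2l// ler_piMl.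
  lra.
- rewrite /dense edges_converse edgesE natr_sum mulrAC mulrC.
  rewrite mulr_natl -sumr_const; apply: ler_sum => y yN.
  have h1 := hN y yN.
  have h2 : (#|nbhd e X y| <= #|nbhd e (X :\: S) y| + s)%N.
    rewrite -Ss (leq_trans _ (leq_card_setU _ _))// subset_leq_card//.
    by apply/subsetP => x; rewrite !inE; case: (x \in S) => //= ->.
  have h3 : #|nbhd e X y|%:R <= #|nbhd e (X :\: S) y|%:R + s%:R :> R.
    by rewrite -natrD ler_nat.
  have h4 : r * p * #|X :\: S|%:R <= r * (p * #|X|%:R).
    rewrite -mulrA; do 2!rewrite ler_wpM2l ?(ltW p0)//.
    by rewrite ler_nat subset_leq_card// subsetDl.
  lra.
exists (S :|: S'), T; split=> //.
- by rewrite subUset SX (subset_trans S'X)// subsetDl.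
- exact: subset_trans NY.
- rewrite cardsU Ss S'k (_ : S :&: S' = set0) ?cards0 ?subn0//.
  apply/setP => x; rewrite !inE; apply/andP => -[xS /(subsetP S'X)].
  by rewrite !inE xS.
- move=> x y /setUP[xS|xS'] yT; first by apply: cpl => //; exact: (subsetP TN).
  exact: cpl'.
Qed.

(** * Iterating on alternate sides *)

(** Since [p <= 1 / 2], the bound on [A * p ^+ b] makes [p * A] exponentially large
    in [b]; this is why choosing distinct vertices costs almost nothing. *)
Lemma exp2_le_size (R : realFieldType) (A p c : R) b : 0 <= A -> 0 < p <= 1 / 2 ->
  (0 < b)%N -> c <= A * p ^+ b -> c * 2 ^+ b <= 2 * (p * A).
Proof.
move=> A0 /andP[p0 p1]; case: b => // b _ hc.
have h : (2 * p) ^+ b <= 1 by rewrite exprn_ile1//; lra.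
have := ler_wpM2r (exprn_ge0 b.+1 (ler0n R 2)) hc.
move/le_trans; apply.
rewrite (_ : A * _ * _ = A * (2 * p) * (2 * p) ^+ b); last first.
  by rewrite exprMn !exprS; ring.
rewrite (_ : 2 * (p * A) = A * (2 * p) * 1); last by ring.
by rewrite ler_wpM2l// mulr_ge0//; lra.
Qed.

Section Iteration.
Variable R : realFieldType.

(** The lower bound demanded of [#|X| * p ^+ b] and [#|Y| * p ^+ a].  Its increase
    in [b] pays for the losses: replacing [b] by [k <= b / 2] lowers it by at least
    [600 / b].  Its size is chosen so that it exceeds [b + 1] for [16 <= b <= 44],
    where one averaging step concludes, and stays below 64, which is what the
    first step leaves. *)
Definition reserve (b : nat) : R := 60 - 600 / b%:R.

(** With [r = 1 - 4 / b ^ 2], each of [1 - r ^ b], [1 - r ^ k] and [r ^ (a - k)] is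
    at most [4 / b], the last because [a - k] is at least of order [b ^ 3]. *)
Lemma log_step_estimates (a b k : nat) (r : R := 1 - 4 / b%:R ^+ 2) :
  (45 <= b)%N -> (17 <= k)%N -> (2 * k <= b)%N -> (b ^ 3 <= 4 * a)%N ->
  [/\ 0 < r, r + a%:R^-1 <= 1,
      reserve k <= reserve b * ((1 - a%:R^-1) * r ^+ b) &
      reserve k <= reserve b * ((1 - 2 * a%:R^-1 - r ^+ (a - k)) * r ^+ k)].
Proof.
move=> b45 k17 kb ba.
have ba1 : (45 * b ^ 2 <= 4 * a)%N.
  by apply: leq_trans ba; rewrite [(b ^ 3)%N]expnS leq_mul2r b45 orbT.
have abk : (2 * b <= a /\ a <= 2 * (a - k))%N by nia.
have [ab ak] := abk.
have b45R : 45%:R <= b%:R :> R by rewrite ler_nat.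
have kbR : 2 * k%:R <= b%:R :> R by rewrite -natrM ler_nat.
have k17R : 17%:R <= k%:R :> R by rewrite ler_nat.
have abR : 2 * b%:R <= a%:R :> R by rewrite -natrM ler_nat.
have akR : a%:R <= 2 * (a - k)%:R :> R by rewrite -natrM ler_nat.
have ba1R : 45 * b%:R ^+ 2 <= 4 * a%:R :> R by rewrite -natrX -!natrM ler_nat.
have baR : b%:R ^+ 3 <= 4 * a%:R :> R by rewrite -natrX -natrM ler_nat.
rewrite {}/r /reserve; move: (a - k)%N akR => s; move=> saR.
clear b45 k17 kb ba ba1 abk ab ak.
set u : R := b%:R^-1; set v : R := k%:R^-1; set w : R := a%:R^-1.
have u0 : 0 < u by rewrite invr_gt0; lra.
have ub : u * b%:R = 1 by rewrite mulVf// gt_eqF//; lra.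
have u16 : u <= 1 / 45 by nra.
have w0 : 0 < w by rewrite invr_gt0; lra.
have wa : w * a%:R = 1 by rewrite mulVf// gt_eqF//; lra.
have v0 : 0 < v by rewrite invr_gt0; lra.
have vk : v * k%:R = 1 by rewrite mulVf// gt_eqF//; lra.
have uv : 2 * u <= v.
  rewrite -(ler_pM2r (_ : 0 < b%:R)); last lra.
  rewrite -mulrA ub; nra.
have wu : w <= u by nra.
have ub2 : b%:R ^+ 2 * u ^+ 2 = 1 by rewrite -exprMn mulrC ub expr1n.
have uu0 : 0 < u ^+ 2 by rewrite exprn_gt0.
have wu2 : w <= 4 * u ^+ 2 by nra.
rewrite -exprVn -/u.
have uu : u ^+ 2 <= u / 45 by rewrite expr2; nra.
set r := 1 - _.
have r0 : 0 < r by rewrite /r; lra.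
have rE : 4 * u ^+ 2 = 1 - r by rewrite /r; ring.
have rb : 1 - 4 * u <= r ^+ b.
  have := @bernoulli _ (4 * u ^+ 2) b ltac:(lra); rewrite -/r.
  have -> : b%:R * (4 * u ^+ 2) = 4 * u * (u * b%:R) by ring.
  by rewrite ub mulr1.
have rk : 1 - 2 * u <= r ^+ k.
  have := @bernoulli _ (4 * u ^+ 2) k ltac:(lra); rewrite -/r.
  have : k%:R * (4 * u ^+ 2) <= 2 * u; last lra.
  have -> : k%:R * (4 * u ^+ 2) = 2 * u * (u * (2 * k%:R)) by ring.
  by rewrite ler_piMr//; nra.
have rs0 : 0 <= r ^+ s by rewrite exprn_ge0// ltW.
have rs : r ^+ s <= 2 * u.
  have := @bernoulli_inv _ (4 * u ^+ 2) s ltac:(lra); rewrite -/r.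
  have h : b%:R <= 2 * (s%:R * (4 * u ^+ 2)).
    have -> : b%:R = b%:R ^+ 3 * u ^+ 2 :> R by rewrite exprS -mulrA ub2 mulr1.
    rewrite (_ : 2 * _ = 8 * s%:R * u ^+ 2); last by ring.
    by rewrite ler_wpM2r ?(ltW uu0)//; lra.
  set z := s%:R * _ in h *; move=> hz.
  have : r ^+ s * b%:R <= 2 by nra.
  move=> hzb; rewrite -(ler_pM2r (_ : 0 < b%:R)); last lra.
  by rewrite -[2 * u * _]mulrA ub mulr1.
have rk1 : r ^+ k <= 1 by rewrite exprn_ile1//; lra.
split=> //; first lra.
  have : (1 - u) * (1 - 4 * u) <= (1 - w) * r ^+ b by nra.
  nra.
have : (1 - 4 * u) * (1 - 2 * u) <= (1 - 2 * w - r ^+ s) * r ^+ k by nra.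
nra.
Qed.


Lemma reserve_ge b : (16 <= b)%N -> 22 <= reserve b.
Proof.
rewrite -(ler_nat R) => hb; have b0 : 0 < b%:R :> R by lra.
rewrite /reserve lerBrDl -lerBrDr ler_pdivrMr//; lra.
Qed.

Lemma reserve_final a b : (16 <= b <= 44)%N -> (32 <= a)%N ->
  b%:R <= reserve b * (1 - 2 * (a%:R^-1 / 10)).
Proof.
rewrite -!(ler_nat R) /reserve => /andP[b16 b44] a32.
set u : R := b%:R^-1; set w : R := a%:R^-1.
have u0 : 0 < u by rewrite invr_gt0; lra.
have ub : u * b%:R = 1 by rewrite mulVf// gt_eqF//; lra.
have w0 : 0 < w by rewrite invr_gt0; lra.
have wa : w * a%:R = 1 by rewrite mulVf// gt_eqF//; lra.
have w32 : w <= 1 / 32 by nra.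
have : b%:R <= 59 - 600 * u by nra.
nra.
Qed.

(** The first step uses [r = 2 ^ (- 1 / t)], which balances the loss [r ^ t] on one
    side against [1 - r ^ t] on the other.  As [1 - 1 / t <= r], the surplus
    exponent [k] costs at most [k / t], covered by the term [600 / k]. *)
Lemma first_step_estimates (t k : nat) (r : R) (tau := t%:R^-1 / 32) :
  (121 <= t)%N -> (16 <= k)%N -> (16 * k ^ 2 <= 75 * t)%N -> (k <= t)%N ->
  0 < r -> 2 * r ^+ t = 1 ->
  [/\ r <= 1, r + tau <= 1,
      reserve k <= 128 * ((1 - tau) * r ^+ t) &
      reserve k <= 128 * ((1 - 2 * tau - r ^+ (t - k)) * r ^+ k)].
Proof.
move=> t121 k16 kt2 kt r0 rt.
have rskE : r ^+ (t - k) * r ^+ k = r ^+ t by rewrite -exprD subnK.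
have t121R : 121%:R <= t%:R :> R by rewrite ler_nat.
have k16R : 16%:R <= k%:R :> R by rewrite ler_nat.
have kt2R : 16 * k%:R ^+ 2 <= 75 * t%:R :> R by rewrite -natrX -!natrM ler_nat.
have tpos : (0 < t)%N by apply: leq_trans t121.
rewrite /tau /reserve; clear t121 k16 kt2 tau.
set x : R := t%:R^-1; set v : R := k%:R^-1.
have x0 : 0 < x by rewrite invr_gt0; lra.
have xt : t%:R * x = 1 by rewrite mulfV// gt_eqF//; lra.
have x121 : x <= 1 / 121 by nra.
have v0 : 0 < v by rewrite invr_gt0; lra.
have vk : v * k%:R = 1 by rewrite mulVf// gt_eqF//; lra.
have rx : r <= 1 - x / 2.
  rewrite leNgt; apply/negP => h.
  have : (1 - x / 2) ^+ t < r ^+ t by rewrite ltrXn2r ?nnegrE -?lt0n//; lra.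
  have := @bernoulli _ (x / 2) t ltac:(lra).
  by rewrite mulrA xt; lra.
have xr : 1 - x <= r.
  rewrite leNgt; apply/negP => h.
  have : r ^+ t < (1 - x) ^+ t by rewrite ltrXn2r ?nnegrE -?lt0n//; lra.
  have := @bernoulli_inv _ x t ltac:(lra).
  by rewrite xt; lra.
have rk1 : r ^+ k <= 1 by rewrite exprn_ile1//; lra.
have rk : 1 - k%:R * x <= r ^+ k.
  apply: le_trans (@bernoulli _ x k ltac:(lra)) _.
  by rewrite lerXn2r ?nnegrE//; lra.
have kx : 16 * (k%:R * x) <= 75 * v.
  have -> : k%:R * x = v * (k%:R ^+ 2 * x) by rewrite expr2 !mulrA vk mul1r.
  have : 16 * (k%:R ^+ 2 * x) <= 75; last nra.
  have -> : 75 = 75 * t%:R * x :> R by rewrite -mulrA xt mulr1.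
  by rewrite mulrA ler_wpM2r// ltW.
split; [lra|lra|nra|].
rewrite [(_ - _ - _) * _]mulrBl rskE; nra.
Qed.

(** The two conditions relating [a] and [b] say that [b] is [3 * log2 a] rounded
    up.  Strong induction on [b]: when [b > 44], the demand (a, b) is replaced by
    (b, k) with [k] the rounded value of [3 * log2 b]. *)
Lemma biclique_log b : forall a (U W : finType) (e : U -> W -> bool)
    (X : {set U}) (Y : {set W}) (p : R),
  (16 <= b)%N -> (a ^ 3 <= 2 ^ b)%N -> (2 ^ b < 2 * a ^ 3)%N ->
  0 < p <= 1 / 2 -> dense e p X Y ->
  reserve b <= #|X|%:R * p ^+ b -> reserve b <= #|Y|%:R * p ^+ a ->
  has_biclique e X Y a b.
Proof.
elim/ltn_ind: b => b IH a U W e X Y p b16 ab1 ab2 hp hd hX hY.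
have a32 := ge32_of_exp2_cube b16 ab2.
have b0 : (0 < b)%N by apply: leq_trans b16.
have a0 : (0 < a)%N by apply: leq_trans a32.
have aR : 0 < a%:R :> R by rewrite ltr0n.
have w0 : 0 < a%:R^-1 :> R by rewrite invr_gt0.
have K22 := reserve_ge b16.
have /andP[p0 p1] := hp.
have p01 : 0 < p <= 1 by rewrite p0; lra.
have pA : 10 * a%:R ^+ 3 <= p * #|X|%:R.
  have h1 := exp2_le_size (ler0n _ _) hp b0 hX.
  have h2 : a%:R ^+ 3 <= 2 ^+ b :> R by rewrite -!natrX ler_nat.
  have h3 : 22 * 2 ^+ b <= reserve b * 2 ^+ b.
    by rewrite ler_wpM2r// exprn_ge0.
  have := exprn_ge0 3 (ltW aR); lra.
have a2 : a%:R ^+ 2 = a%:R^-1 / 10 * (10 * a%:R ^+ 3) :> R.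
  by field; rewrite gt_eqF.
have hs c : (c <= a)%N -> c%:R ^+ 2 <= a%:R^-1 / 10 * (p * #|X|%:R).
  move=> ca; apply: le_trans (_ : a%:R ^+ 2 <= _).
    by rewrite -!natrX ler_nat leq_exp2r.
  by rewrite a2 ler_wpM2l//; lra.
have w1 : a%:R^-1 <= 1 :> R by rewrite invf_le1// ler1n.
have [b44|b45] := leqP b 44.
  apply: (@biclique_direct _ _ _ e X Y p (a%:R^-1 / 10)) => //.
  - by lra.
  - exact: hs.
  - apply: le_trans (reserve_final _ a32) _; first by rewrite b16.
    rewrite ler_wpM2r//; lra.
have [k17 kb ba ka] := log_step_sizes b45 ab2.
have [bk1 bk2] := up_log_cube (leq_trans (isT : (1 < 16)%N) b16).
move: k17 kb ka bk1 bk2; set k := up_log 2 (b ^ 3) => k17 kb ka bk1 bk2.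
have [] := log_step_estimates b45 k17 kb ba.
set r : R := 1 - _ => r0 r1 Kb Kk.
have E : ((a - k) + k)%N = a by rewrite subnK// ltnW.
suff : has_biclique e X Y ((a - k) + k) b by rewrite E.
have rp0 : 0 <= r ^+ b by rewrite exprn_ge0// ltW.
have rk0 : 0 <= r ^+ k by rewrite exprn_ge0// ltW.
have pk0 m : 0 < p ^+ m by rewrite exprn_gt0.
have K0 : 0 <= reserve b by lra.
apply: (@biclique_reduce _ _ _ e X Y p r a%:R^-1 (a - k) k b p01) => //.
- exact: ltW.
- exact: ltW.
- by rewrite subn_gt0.
- apply: le_trans (hs _ (leq_subr _ _)) _; rewrite ler_wpM2r//; last lra.
  by rewrite mulr_ge0// ltW.
move=> N X' hN hX' hd'.
apply: (IH k _ b _ _ _ _ _ (r * p)) => //.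
- by apply: leq_trans kb; rewrite mul2n -addnn -[X in (X < _)%N]addn0 ltn_add2l (leq_trans _ k17).
- exact: leq_trans k17.
- apply/andP; split; first exact: mulr_gt0.
  have rle1 : r <= 1 by lra.
  by have := ler_wpM2r (ltW p0) rle1; lra.
- set D := (_ * r ^+ k) in Kk.
  have D0 : 0 <= D.
    rewrite leNgt; apply/negP => D0.
    have := reserve_ge (leq_trans (isT : (16 <= 17)%N) k17).
    by have := mulr_ge0 K0 (_ : 0 <= - D); rewrite ?mulrN; lra.
  apply: (le_trans Kk); apply: (le_trans (ler_wpM2r D0 hY)); rewrite /D.
  rewrite -[X in p ^+ X]E exprD exprMn.
  have := ler_wpM2r (mulr_ge0 (ltW (pk0 k)) rk0) hN.
  by congr (_ <= _); ring.
- apply: (le_trans Kb).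
  apply: le_trans (_ : #|X|%:R * p ^+ b * ((1 - a%:R^-1) * r ^+ b) <= _).
    by rewrite ler_wpM2r// mulr_ge0//; lra.
  rewrite exprMn.
  have := ler_wpM2r (mulr_ge0 (ltW (pk0 b)) rp0) hX'.
  by congr (_ <= _); ring.
Qed.
End Iteration.

(** * The Zarankiewicz bound *)

Lemma edges_setT (n1 n2 : nat) (E : {set 'I_n1 * 'I_n2}) :
  edges (fun x y => (x, y) \in E) setT setT = #|E|.
Proof.
rewrite -sum1_card big_mkcond /= (eq_bigr (fun u => ((u.1, u.2) \in E : nat))).
  by rewrite -(pair_bigA _ (fun x y => ((x, y) \in E : nat))) exchange_big /=;
     apply: eq_big => y; rewrite ?inE// => _; apply: eq_bigl => x; rewrite inE.
by case=> x y _ /=; case: (_ \in E).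
Qed.

(** For [t > 120], the reduction leads from (t, t) to (t, k) with [k] about
    [3 * log2 t], where [biclique_log] takes over. *)
Lemma balanced_biclique (R : realType) (U W : finType) (e : U -> W -> bool)
    (X : {set U}) (Y : {set W}) (p : R) t :
  (0 < t)%N -> 0 < p <= 1 / 2 -> dense e p X Y ->
  128 <= #|X|%:R * p ^+ t -> 128 <= #|Y|%:R * p ^+ t ->
  has_biclique e X Y t t.
Proof.
move=> t0 hp hd hX hY.
have pA : 64 * 2 ^+ t <= p * #|X|%:R.
  by have := exp2_le_size (ler0n _ _) hp t0 hX; lra.
have /andP[p0 p1] := hp.
have p01 : 0 < p <= 1 by rewrite p0; lra.
have [t120|t121] := leqP t 120.
  apply: (@biclique_direct _ _ _ e X Y p (1 / 32)) => //; first lra.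
    have : t%:R ^+ 2 <= 2 * 2 ^+ t :> R by rewrite -!natrX -natrM ler_nat exp2_ge_sqr.
    lra.
  have : t%:R <= 120%:R :> R by rewrite ler_nat.
  lra.
have [k21 kt2 kt] := first_step_sizes t121.
have [tk1 tk2] := up_log_cube (leq_trans (isT : (1 < 121)%N) t121).
move: k21 kt2 kt tk1 tk2; set k := up_log 2 (t ^ 3) => k21 kt2 kt tk1 tk2.
pose r : R := 2 `^ (- t%:R^-1).
have tR : 0 < t%:R :> R by rewrite ltr0n.
have r0 : 0 < r by rewrite powR_gt0.
have rt : 2 * r ^+ t = 1.
  rewrite -powR_mulrn ?(ltW r0)// -powRrM mulNr mulVf ?gt_eqF//.
  by rewrite powR_inv1// mulfV ?pnatr_eq0.
have k16 : (16 <= k)%N by apply: leq_trans k21.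
have [r1 rtau Kt Kk] := first_step_estimates t121 k16 kt2 (ltnW kt) r0 rt.
have E : ((t - k) + k)%N = t by rewrite subnK// ltnW.
suff : has_biclique e X Y ((t - k) + k) t by rewrite E.
move: (rtau) (Kt) (Kk); set tau := t%:R^-1 / 32 => rtau' Kt' Kk'.
have tau0 : 0 < tau by rewrite divr_gt0// invr_gt0.
apply: (@biclique_reduce _ _ _ e X Y p r tau (t - k) k t p01) => //.
- exact: ltW.
- exact: ltW.
- by rewrite subn_gt0.
- apply: le_trans (_ : t%:R ^+ 2 <= _).
    by rewrite -!natrX ler_nat leq_exp2r// leq_subr.
  have h : t%:R ^+ 3 <= 2 ^+ t :> R.
    by rewrite -!natrX ler_nat exp2_ge_pow3// (leq_trans _ t121).
  have -> : t%:R ^+ 2 = tau * (32 * t%:R ^+ 3).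
    by rewrite /tau; field; rewrite gt_eqF.
  rewrite ler_wpM2l ?(ltW tau0)//; have := exprn_ge0 3 (ltW tR); lra.
move=> N X' hN hX' hd'.
have rk0 m : 0 < r ^+ m by rewrite exprn_gt0.
have pk0 m : 0 < p ^+ m by rewrite exprn_gt0.
apply: (@biclique_log R k t _ _ _ _ _ (r * p)) => //.
- apply/andP; split; first exact: mulr_gt0.
  by have := ler_wpM2r (ltW p0) r1; lra.
- set D := (_ * r ^+ k) in Kk'.
  have D0 : 0 <= D by have := reserve_ge R k16; lra.
  apply: (le_trans Kk'); apply: (le_trans (ler_wpM2r D0 hY)); rewrite /D.
  rewrite -[X in p ^+ X]E exprD exprMn.
  have := ler_wpM2r (mulr_ge0 (ltW (pk0 k)) (ltW (rk0 k))) hN.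
  by congr (_ <= _); ring.
- set D := (_ * r ^+ t) in Kt'.
  have D0 : 0 <= D by have := reserve_ge R k16; lra.
  apply: (le_trans Kt'); apply: (le_trans (ler_wpM2r D0 hX)); rewrite /D.
  rewrite exprMn.
  have := ler_wpM2r (mulr_ge0 (ltW (pk0 t)) (ltW (rk0 t))) hX'.
  by congr (_ <= _); ring.
Qed.

Theorem corollary5p2 (R : realType) (t n1 n2 : nat)
    (ht : (0 < t)%N) (hn1 : (0 < n1)%N) (hn2 : (0 < n2)%N)
    (hn : (128 * 2 ^ t <= minn n1 n2)%N) :
  (zarankiewicz n1 n2 t t)%:R <
    (128 : R) `^ (1 / t%:R) * (n1%:R * n2%:R)
      * (minn n1 n2)%:R `^ (- (1 / t%:R)).
Proof.
move: hn; set n := minn n1 n2 => hn.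
have n0 : (0 < n)%N by rewrite leq_min hn1.
have nR : 0 < n%:R :> R by rewrite ltr0n.
have tR : t%:R != 0 :> R by rewrite pnatr_eq0 -lt0n.
pose p : R := 128 `^ (1 / t%:R) * n%:R `^ (- (1 / t%:R)).
have p0 : 0 < p by rewrite mulr_gt0 ?powR_gt0.
have pt : n%:R * p ^+ t = 128.
  rewrite /p exprMn -!powR_mulrn ?powR_ge0// -!powRrM mulNr divfK//.
  by rewrite powRr1// powR_inv1 ?ler0n// mulrCA mulfV ?mulr1 ?gt_eqF.
have p1 : p <= 1 / 2.
  rewrite leNgt; apply/negP => h.
  have h1 : (1 / 2) ^+ t < p ^+ t by rewrite ltrXn2r -?lt0n ?nnegrE//; lra.
  have h2 : 128 * 2 ^+ t <= n%:R :> R by rewrite -natrX -natrM ler_nat.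
  have h3 : 2 ^+ t * (1 / 2) ^+ t = 1 :> R.
    by rewrite -exprMn (_ : 2 * _ = 1) ?expr1n//; lra.
  have : 128 * 2 ^+ t * (1 / 2) ^+ t < n%:R * p ^+ t.
    apply: le_lt_trans (_ : n%:R * (1 / 2) ^+ t < _); last by rewrite ltr_pM2l.
    by rewrite ler_wpM2r ?exprn_ge0//; lra.
  by rewrite pt -mulrA h3 mulr1 ltxx.
have -> : 128 `^ (1 / t%:R) * (n1%:R * n2%:R) * n%:R `^ (- (1 / t%:R))
  = p * n1%:R * n2%:R by rewrite /p; ring.
have pos : 0 < p * n1%:R * n2%:R.
  by apply: mulr_gt0; [apply: mulr_gt0|]; rewrite ?ltr0n.
rewrite /zarankiewicz; elim/big_ind: _ => [//|i j hi hj|E hE].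
  by rewrite /maxn; case: ifP.
rewrite ltNge; apply: contra hE => hE.
have [||||S [T [_ _ Sc Tc cpl]]] :=
  @balanced_biclique R _ _ (fun x y => (x, y) \in E) setT setT p t ht.
- by rewrite p0.
- by rewrite /dense edges_setT !cardsT !card_ord.
- rewrite cardsT card_ord -pt ler_wpM2r ?exprn_ge0 ?(ltW p0)//.
  by rewrite ler_nat geq_minl.
- rewrite cardsT card_ord -pt ler_wpM2r ?exprn_ge0 ?(ltW p0)//.
  by rewrite ler_nat geq_minr.
apply/existsP; exists S; apply/existsP; exists T.
rewrite Sc Tc !eqxx /=; apply/subsetP => -[x y] /setXP[xS yT].
exact: cpl.
Qed.
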